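(* Let $p$ be a prime, let $G$ be a semi-abelian finite $p$-group, and let $N$ be a normal subgroup of $G$ with $N \neq 1$ such that $G/N$ is neither cyclic nor a generalized quaternion group. Let $\operatorname{Z}(N)$ be the center of $N$, regarded as a $G/N$-module with the action induced by conjugation in $G$. Then the Tate cohomology group $\hat{H}^n(G/N,\operatorname{Z}(N))$ is non-zero for all integers $n$.
   Context: A finite $p$-group $G$ is called semi-abelian (in M. Y. Xu's terminology, strongly semi-$p$-abelian) if for all $x,y\in G$ and every positive integer $n$ one has $(xy^{-1})^{p^n}=1 \Leftrightarrow x^{p^n}=y^{p^n}$. The groups $\hat{H}^n(Q,A)$, $n\in\mathbb{Z}$, denote the Tate cohomology groups of a finite group $Q$ with coefficients in a $Q$-module $A$. The conjugation action of $G$ on $\operatorname{Z}(N)$ is trivial when restricted to $N$, so it induces an action of $G/N$. *)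

(* Defs.v *)
From HB Require Import structures.
From mathcomp Require Import all_boot all_order all_algebra all_fingroup.
From mathcomp Require Import all_solvable.

Set Implicit Arguments.
Unset Strict Implicit.
Unset Printing Implicit Defensive.

Import GRing.Theory FinRing.Theory FiniteModule.
Local Open Scope ring_scope.

Definition semi_abelian (p : nat) (gT : finGroupType) (G : {group gT}) : Prop :=
  forall x y : gT, x \in G -> y \in G -> forall n : nat, (0 < n)%N ->
    ((x * y^-1) ^+ (p ^ n) = 1 <-> x ^+ (p ^ n) = y ^+ (p ^ n))%g.

Definition generalized_quaternion (gT : finGroupType) (G : {group gT}) : Prop :=
  exists2 m : nat, (2 < m)%N & (G \isog 'Q_(2 ^ m))%g.

(* Finite left Z[Q]-modules, for Q a finite group. *)
Record gmodule (Q : finGroupType) := GModule {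
  gmod_sort :> finZmodType;
  gact : Q -> gmod_sort -> gmod_sort;
  gactD : forall x, {morph gact x : a b / a + b};
  gact1 : forall a, gact 1%g a = a;
  gactM : forall x y a, gact (x * y)%g a = gact x (gact y a)
}.

(* A homomorphism of finite abelian groups as a MathComp morphism, so that     *)
(* kernels, images and quotients are those of finite group theory.             *)
Definition zmod_morphism (U V : finZmodType) (f : U -> V)
    (fD : {morph f : u v / u + v}) : {morphism [set: U] >-> V} :=
  @Morphism U V [set: U] f (in2W fD).

Section Tate.

Variables (Q : finGroupType) (A : gmodule Q).

(* In degree n the standard resolution has both C^n(Q, A) = Map(Q^n, A) and    *)
(* C_n(Q, A) = A (x) Z[Q^n], the latter identified with Map(Q^n, A) by         *)
(* c <-> \sum_t c(t) (x) [t_0 | ... | t_(n-1)].                                *)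
Definition chain (n : nat) := {ffun {ffun 'I_n -> Q} -> A}.

HB.instance Definition _ (n : nat) := GRing.Zmodule.on (chain n).
HB.instance Definition _ (n : nat) := Finite.on (chain n).

(* The i-th face of [t_0 | ... | t_n]: drop t_0 if i = 0, drop t_n if          *)
(* i = n + 1, and otherwise replace t_(i-1), t_i by their product.             *)
Definition face (n : nat) (i : 'I_n.+2) (t : {ffun 'I_n.+1 -> Q}) :
    {ffun 'I_n -> Q} :=
  [ffun j : 'I_n => let u := t (widen_ord (leqnSn n) j) in
                    let v := t (lift ord0 j) in
    if (j.+1 < i)%N then u else if j.+1 == i then (u * v)%g else v].

(* (d f)(t) = t_0 . f(face_0 t) + \sum_(1 <= k <= n + 1) (-1)^k f(face_k t).   *)
Definition coboundary (n : nat) (f : chain n) : chain n.+1 :=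
  [ffun t : {ffun 'I_n.+1 -> Q} => gact (t ord0) (f (face ord0 t))
    + \sum_(i < n.+1) f (face (lift ord0 i) t) *~ (-1) ^+ i.+1].

(* d(a (x) [t]) = t_0^-1 . a (x) [face_0 t]                                    *)
(*                + \sum_(1 <= k <= n + 1) (-1)^k a (x) [face_k t],            *)
(* A being a right module via a . g = g^-1 . a.                                *)
Definition boundary (n : nat) (c : chain n.+1) : chain n :=
  [ffun s : {ffun 'I_n -> Q} =>
    \sum_(t | face ord0 t == s) gact (t ord0)^-1%g (c t)
    + \sum_(i < n.+1) \sum_(t | face (lift ord0 i) t == s) c t *~ (-1) ^+ i.+1].

Definition norm (c : chain 0) : chain 0 :=
  [ffun t : {ffun 'I_0 -> Q} => \sum_(x : Q) gact x (c t)].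

Lemma coboundaryD (n : nat) : {morph @coboundary n : f g / f + g}.
Proof.
move=> f g; apply/ffunP=> t; rewrite !ffunE gactD addrACA -big_split /=.
by congr (_ + _); apply: eq_bigr => i _; rewrite ffunE mulrzDl.
Qed.

Lemma boundaryD (n : nat) : {morph @boundary n : f g / f + g}.
Proof.
move=> f g; apply/ffunP=> t; rewrite !ffunE addrACA -!big_split /=.
congr (_ + _); apply: eq_bigr => i _; first by rewrite ffunE gactD.
by rewrite -big_split; apply: eq_bigr => s _; rewrite ffunE mulrzDl.
Qed.

Lemma normD : {morph norm : f g / f + g}.
Proof.
move=> f g; apply/ffunP=> t; rewrite !ffunE -big_split.
by apply: eq_bigr => x _; rewrite gactD.
Qed.

(* The complete standard complex                                               *)
(*   ... -> C_1 -> C_0 -norm-> C^0 -> C^1 -> ...                               *)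
(* with C^n in degree n >= 0 and C_n in degree -(n + 1), i.e., Negz n.         *)
Definition tate_chain (n : int) : finZmodType :=
  chain (match n with Posz m => m | Negz m => m end).

Definition tate_cocycles (n : int) : {group tate_chain n} :=
  match n return {group tate_chain n} with
  | Posz m => ('ker (zmod_morphism (@coboundaryD m)))%G
  | Negz 0 => ('ker (zmod_morphism normD))%G
  | Negz m.+1 => ('ker (zmod_morphism (@boundaryD m)))%G
  end.

Definition tate_coboundaries (n : int) : {group tate_chain n} :=
  match n return {group tate_chain n} with
  | Posz 0 => (zmod_morphism normD @* setT)%G
  | Posz m.+1 => (zmod_morphism (@coboundaryD m) @* setT)%G
  | Negz m => (zmod_morphism (@boundaryD m) @* setT)%G
  end.

Definition tate_cohomology (n : int) : {group coset_of (tate_coboundaries n)} :=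
  (tate_cocycles n / tate_coboundaries n)%G.

End Tate.

Section CenterModule.

Local Open Scope group_scope.

Variables (gT : finGroupType) (G N : {group gT}).

Definition center_zmod : finZmodType := fmod_of (center_abelian N).

(* Left action of G / N on 'Z(N): the class of g sends u to g u g^-1, i.e., to *)
(* u ^ g^-1 (see center_actE).                                                 *)
Definition center_act (q : subg_of (G / N)) (u : center_zmod) : center_zmod :=
  actr u (repr (sgval q))^-1.

Lemma norm_center_repr (q : coset_of N) : repr q \in 'N('Z(N)).
Proof. exact: (subsetP (char_norms (center_char N))) (repr_coset_norm q). Qed.

Lemma val_center_act q u :
  fmval (center_act q u) = fmval u ^ (repr (sgval q))^-1.
Proof. by rewrite [LHS]fmvalJ // groupV norm_center_repr. Qed.

Lemma conj_center_coset (u : center_zmod) (x y : gT) :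
    x \in 'N(N) -> y \in 'N(N) -> coset N x = coset N y ->
  fmval u ^ x^-1 = fmval u ^ y^-1.
Proof.
move=> Nx Ny /(rcoset_kercosetP Nx Ny)/rcosetP[z Nz ->].
have uyZ: fmval u ^ y^-1 \in 'Z(N).
  rewrite memJ_norm ?fmodP // groupV.
  exact: (subsetP (char_norms (center_char N))) Ny.
have [_ cuN] := centerP _ _ uyZ.
rewrite invMg conjgM; apply/conjg_fixP/commgP; apply: commuteV.
exact: cuN.
Qed.

Lemma center_actE (g : gT) (u : center_zmod) :
  N <| G -> g \in G ->
  fmval (center_act (subg (G / N) (coset N g)) u) = g * fmval u * g^-1.
Proof.
move=> nNG Gg; have Ng := subsetP (normal_norm nNG) _ Gg.
rewrite val_center_act subgK ?mem_quotient //.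
rewrite (conj_center_coset u _ Ng) ?repr_coset_norm ?coset_reprK //.
by rewrite conjgE invgK mulgA.
Qed.

Lemma center_actD q : {morph center_act q : u v / (u + v)%R}.
Proof. exact: actAr. Qed.

Lemma center_act1 u : center_act 1 u = u.
Proof.
apply: val_inj; rewrite [LHS]val_center_act.
by rewrite (conj_center_coset u _ (group1 _)) ?repr_coset_norm ?coset_reprK
  ?morph1 // invg1 conjg1.
Qed.

Lemma center_actM q r u : center_act (q * r) u = center_act q (center_act r u).
Proof.
apply: val_inj; rewrite [LHS]val_center_act [RHS]val_center_act val_center_act.
rewrite -conjgM -invMg; apply: conj_center_coset; rewrite ?groupM ?repr_coset_norm //.
by rewrite coset_reprK coset_morphM ?repr_coset_norm // !coset_reprK.
Qed.

Definition center_module : gmodule (subg_of (G / N)) :=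
  GModule center_actD center_act1 center_actM.

End CenterModule.

(* Main.v *)
(* Write A = Z(N) and Q = G/N.  Dimension shifting turns the vanishing of one *)
(* Tate group of Q in a p-module A into the vanishing in degree 0 for an      *)
(* iterated shift of A.  For p-groups acting on finite p-modules, Herbrand    *)
(* quotients of H/K, K maximal in H, and the existence of fixed points show   *)
(* that degrees 0 and -1 vanish together and that this passes to subgroups    *)
(* (Gaschuetz-Uchida); shifting back, the Tate groups of A itself vanish in   *)
(* degrees 0 and -1 for every E <= Q.  As Q is neither cyclic nor generalized *)
(* quaternion, there is E = <x> x <y> with x, y of order p.  Semi-abelianity, *)
(* with (a g)^p = N_q(a) g^p for g in G of class q, says that the norm        *)
(* N_q a = a + q a + ... + q^(p-1) a has kernel A[p] for every q, and this    *)
(* contradicts the vanishing for E.                                           *)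
Require Import Defs.
From HB Require Import structures.
From mathcomp Require Import all_boot all_order all_algebra all_fingroup.
From mathcomp Require Import all_solvable.

Set Implicit Arguments.
Unset Strict Implicit.
Unset Printing Implicit Defensive.

Import GRing.Theory FinRing.Theory FiniteModule Defs.
Local Open Scope group_scope.
Local Open Scope ring_scope.

(** * Herbrand quotients *)

Lemma card_sum_image (V : finZmodType) (W J : {group V}) (f : {additive V -> V}) :
  (#|[set (f w + j)%R | w in W, j in J]| * #|[set w in W | f w \in J]|
    = #|W| * #|J|)%N.
Proof.
pose F := zmod_morphism (raddfD f).
have cardF (H : {group V}) : #|H| = (#|F @* H| * #|'ker_H F|)%N.
  by rewrite card_morphim setTI mulnC -[LHS](LagrangeI H ('ker F)).
have -> : [set f w + j | w in W, j in J] = (F @* W * J)%g.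
  apply/setP=> v; apply/imset2P/mulsgP=> [[w j Ww Jj ->]|[x j /morphimP[w _ Ww ->] Jj ->]].
    by exists (F w) j => //; apply: mem_morphim; rewrite ?inE.
  by exists w j.
have -> : [set w in W | f w \in J] = (W :&: F @*^-1 J)%g.
  by apply/setP=> w; rewrite !inE.
rewrite (cardF (W :&: F @*^-1 J)%G) (cardF W) /=.
have -> : 'ker_(W :&: F @*^-1 J) F = 'ker_W F.
  rewrite -setIA; congr (_ :&: _); apply/setIidPr.
  by rewrite kerE morphpreS ?sub1G.
have -> : F @* (W :&: F @*^-1 J) = F @* W :&: J.
  apply/setP=> v; apply/morphimP/setIP=> [[w _ /setIP[Ww]]|[/morphimP[w _ Ww ->] Jw]].
    by rewrite !inE => Jw ->; split=> //; apply: mem_morphim; rewrite ?inE.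
  by exists w; rewrite ?inE //= Ww.
by rewrite mulnA -mul_cardG mulnAC.
Qed.

Lemma herbrand (V : finZmodType) (W J : {group V}) (f g : {additive V -> V}) :
    (forall w j, w \in W -> j \in J -> f w + j \in W /\ g (f w + j) \in J) ->
    (forall w, w \in W -> f w \in J -> exists2 v, v \in W & w - g v \in J) ->
  forall w, w \in W -> g w \in J -> exists2 v, v \in W & w - f v \in J.
Proof.
move=> sfg sgf.
pose I h := [set h w + j | w in W, j in J].
pose P (h : V -> V) := [set w in W | h w \in J].
have sIP : I f \subset P g.
  apply/subsetP=> _ /imset2P[w j Ww Jj ->]; rewrite inE.
  by have [-> ->] := sfg w j Ww Jj.
have sPI : P f \subset I g.
  apply/subsetP=> w /[!inE] /andP[Ww Jw]; have [v Wv Jv] := sgf w Ww Jw.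
  by apply/imset2P; exists v (w - g v); rewrite // addrC subrK.
have eq_card : (#|I f| * #|P f| = #|P g| * #|I g|)%N.
  by rewrite card_sum_image [RHS]mulnC card_sum_image.
have eqIP : I f = P g.
  apply/eqP; rewrite eqEcard sIP leqNgt; apply/negP=> ltIP.
  have: (#|I f| * #|P f| < #|P g| * #|I g|)%N.
    apply: leq_ltn_trans (leq_mul (leqnn _) (subset_leq_card sPI)) _.
    rewrite ltn_mul2r ltIP andbT.
    apply/card_gt0P; exists (g 0 + 0); apply/imset2P.
    by exists 0 0 => //; apply: group1.
  by rewrite eq_card ltnn.
move=> w Ww Jw; have: w \in I f by rewrite eqIP inE Ww.
by case/imset2P=> v j Wv Jj ->; exists v => //; rewrite addrC addKr.
Qed.

Lemma onto_mod_inj (V : finZmodType) (W J : {group V}) (f : {additive V -> V}) :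
    J \subset W -> (forall j, j \in J -> f j \in J) ->
    (forall v, v \in W -> exists2 u, u \in W & v - f u \in J) ->
  forall w, w \in W -> f w \in J -> w \in J.
Proof.
move=> sJW sfJ onto w Ww Jfw.
pose P := [set w in W | f w \in J].
have sJP : J \subset P.
  by apply/subsetP=> j Jj; rewrite inE (subsetP sJW) ?sfJ.
have sWI : W \subset [set f w + j | w in W, j in J].
  apply/subsetP=> v /onto[u Wu Ju]; apply/imset2P.
  by exists u (v - f u); rewrite // addrC subrK.
suffices -> : (J : {set V}) = P by rewrite inE Ww.
apply/eqP; rewrite eqEcard sJP /= -(leq_pmul2l (cardG_gt0 W)).
by rewrite -(card_sum_image W J f) leq_mul2r (subset_leq_card sWI) orbT.
Qed.

Lemma morphB_of_D (U V : zmodType) (f : U -> V) :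
  {morph f : a b / a + b} -> {morph f : a b / a - b}.
Proof. by move=> fD a b; apply/eqP; rewrite eq_sym subr_eq -fD subrK. Qed.

Lemma gactB (Q : finGroupType) (A : gmodule Q) (x : Q) :
  {morph @gact Q A x : a b / a - b}.
Proof. exact/morphB_of_D/gactD. Qed.

HB.instance Definition _ (Q : finGroupType) (A : gmodule Q) (x : Q) :=
  GRing.isZmodMorphism.Build A A (@gact Q A x) (@gactB Q A x).

Lemma gact_sum (Q : finGroupType) (A : gmodule Q) (x : Q) I (r : seq I)
    (P : pred I) (F : I -> A) :
  gact x (\sum_(i <- r | P i) F i) = \sum_(i <- r | P i) gact x (F i).
Proof. exact: (raddf_sum (gact x)). Qed.

Section GModule.

Variables (Q : finGroupType) (A : gmodule Q).
Implicit Types (H K : {group Q}) (W J : {group A}).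

Lemma gactK (x : Q) : cancel (@gact Q A x) (gact x^-1%g).
Proof. by move=> a; rewrite -gactM mulVg gact1. Qed.

Lemma gactVK (x : Q) : cancel (gact x^-1%g) (@gact Q A x).
Proof. by move=> a; rewrite -gactM mulgV gact1. Qed.

Definition gact_to (a : A) (x : Q) : A := gact x^-1%g a.

Lemma gact_to_is_action : is_action [set: Q] gact_to.
Proof.
split=> [x a b|a x y _ _]; first by move/(can_inj (@gactK _)).
by rewrite /gact_to invMg gactM.
Qed.

Canonical gact_action := Action gact_to_is_action.

Definition stable (H : {set Q}) (W : {set A}) :=
  forall h w, h \in H -> w \in W -> gact h w \in W.

Lemma fixed_coset (p : nat) H W J :
    prime p -> p.-group H -> p.-group W -> J \subset W -> stable H W -> stable H J ->
    ~~ (W \subset J) ->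
  exists w, [/\ w \in W, w \notin J & forall h, h \in H -> gact h w - w \in J].
Proof.
move=> p_pr pH pW sJW stW stJ nsWJ.
pose S := rcosets J W.
have actS : [acts H, on S | gact_action^*].
  apply/subsetP=> h Hh; rewrite !inE /=; apply/subsetP=> _ /rcosetsP[w Ww ->].
  rewrite inE; apply/rcosetsP; exists (gact h^-1%g w).
    by rewrite stW ?groupV.
  apply/setP=> v; rewrite mem_rcoset; apply/imsetP/idP => [[u]|Jv].
    rewrite mem_rcoset => Ju ->; have := stJ _ _ (groupVr Hh) Ju.
    by rewrite !zmodMgE !zmodVgE gactB.
  exists (gact h v); last by rewrite /= /gact_to gactK.
  rewrite mem_rcoset; have := stJ _ _ Hh Jv.
  by rewrite !zmodMgE !zmodVgE gactB gactVK.
have cardS : #|S| = #|W : J| by [].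
have pS : (p %| #|S|)%N.
  have pWJ : p.-nat #|W : J| by apply: pnat_dvd pW; apply: dvdn_indexg.
  have := pWJ; rewrite cardS => /p_natP.
  case=> [[|n] eWJ]; last by rewrite eWJ expnS dvdn_mulr.
  by move/eqP: eWJ; rewrite indexg_eq1 (negPf nsWJ).
have := pgroup_fix_mod pH actS; rewrite (eqnP pS) => /esym/eqP pF.
have FJ : (J : {set A}) \in 'Fix_(S | gact_action^*)(H).
  rewrite inE; apply/andP; split.
    by apply/rcosetsP; exists 1%g; rewrite ?group1 ?mulg1 ?rcoset1.
  apply/afixP=> h Hh; apply/setP=> v; apply/imsetP/idP=> [[u Ju ->]|Jv].
    by apply: stJ; rewrite ?groupV.
  by exists (gact h v); [apply: stJ | rewrite /= /gact_to gactK].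
have [X] : exists X, X \in 'Fix_(S | gact_action^*)(H) :\ (J : {set A}).
  apply/set0Pn; apply: contraL pF => /eqP F0.
  by rewrite (cardsD1 (J : {set A})) FJ F0 cards0 addn0 modn_small ?prime_gt1.
case/setD1P=> neXJ /setIP[/rcosetsP[w Ww defX] /afixP fixX].
exists w; split=> // [|h Hh].
  by apply: contra neXJ => Jw; rewrite defX rcoset_id.
have: gact h w \in X.
  rewrite -(fixX _ (groupVr Hh)); apply/imsetP; exists w.
    by rewrite defX rcoset_refl.
  by rewrite /= /gact_to invgK.
by rewrite defX mem_rcoset.
Qed.

End GModule.

(** * Norm and augmentation of a subgroup *)

Section NormAug.

Variables (Q : finGroupType) (A : gmodule Q).
Implicit Types (H K : {group Q}) (J : {group A}).

Definition nrm (H : {set Q}) (a : A) : A := \sum_(x in H) gact x a.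

Lemma nrmB H : {morph nrm H : a b / a - b}.
Proof. by move=> a b; rewrite /nrm -sumrB; apply: eq_bigr => x _; rewrite gactB. Qed.

HB.instance Definition _ H := GRing.isZmodMorphism.Build A A (nrm H) (@nrmB H).

Definition gdiff (x : Q) (a : A) : A := gact x a - a.

Lemma gdiffB x : {morph gdiff x : a b / a - b}.
Proof. by move=> a b; rewrite /gdiff gactB !opprD addrACA. Qed.

HB.instance Definition _ x := GRing.isZmodMorphism.Build A A (gdiff x) (@gdiffB x).

Definition gsum (x : Q) (n : nat) (a : A) : A := \sum_(i < n) gact (x ^+ i)%g a.

Lemma gsumB x n : {morph gsum x n : a b / a - b}.
Proof. by move=> a b; rewrite /gsum -sumrB; apply: eq_bigr => i _; rewrite gactB. Qed.

HB.instance Definition _ x n :=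
  GRing.isZmodMorphism.Build A A (gsum x n) (@gsumB x n).

Definition fixg (H : {set Q}) : {set A} := [set a | [forall x in H, gact x a == a]].

Lemma fixgP H a : reflect (forall x, x \in H -> gact x a = a) (a \in fixg H).
Proof. by rewrite inE; apply: (iffP forall_inP) => ha x Hx; apply/eqP/ha. Qed.

Lemma fixg_group_set H : group_set (fixg H).
Proof.
apply/group_setP; split=> [|a b /fixgP fa /fixgP fb]; apply/fixgP=> x Hx.
  exact: raddf0 (gact x).
by rewrite zmodMgE gactD fa ?fb.
Qed.
Canonical fixg_group H := Group (fixg_group_set H).

Definition aug (H : {set Q}) : {group A} :=
  <<[set gdiff x a | x in H, a in [set: A]]>>%G.

Lemma mem_aug (H : {set Q}) x a : x \in H -> gact x a - a \in aug H.
Proof. by move=> Hx; apply: mem_gen; apply/imset2P; exists x a; rewrite ?inE. Qed.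

Lemma aug_sub (H : {set Q}) J :
  (forall x a, x \in H -> gact x a - a \in J) -> aug H \subset J.
Proof.
move=> sJ; rewrite gen_subG; apply/subsetP=> _ /imset2P[x a Hx _ ->].
exact: sJ.
Qed.

Lemma memgD J a b : a \in J -> b \in J -> a + b \in J.
Proof. exact: groupM. Qed.

Lemma memgN J a : a \in J -> - a \in J.
Proof. by move=> Ja; rewrite -zmodVgE groupV. Qed.

Lemma memgB J a b : a \in J -> b \in J -> a - b \in J.
Proof. by move=> Ja /memgN; apply: memgD. Qed.

Lemma memg0 J : 0 \in J.
Proof. exact: group1. Qed.

Lemma memg_sum J I (r : seq I) (P : pred I) (F : I -> A) :
  (forall i, P i -> F i \in J) -> \sum_(i <- r | P i) F i \in J.
Proof.
move=> JF; elim/big_ind: _ => //; [exact: memg0 | exact: memgD].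
Qed.

(* Vanishing of the Tate cohomology of H in degrees 0 and -1. *)
Definition tate0 H := forall a, a \in fixg H -> exists b, a = nrm H b.
Definition tateN1 H := forall a, nrm H a = 0 -> a \in aug H.

Lemma nrm_gact H x a : x \in 'N(H) -> nrm H (gact x a) = gact x (nrm H a).
Proof.
move=> Nx; rewrite [RHS]gact_sum /nrm.
rewrite (reindex_inj (conjg_inj x^-1%g)) /=.
apply: eq_big => [y|y _]; first by rewrite memJ_norm ?groupV.
by rewrite -!gactM conjgE invgK -!mulgA mulVg mulg1.
Qed.

Lemma gact_nrm H x a : x \in H -> gact x (nrm H a) = nrm H a.
Proof.
move=> Hx; rewrite gact_sum /nrm [RHS](reindex_inj (mulgI x)) /=.
by apply: eq_big => [y|y _]; rewrite ?groupMl -?gactM.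
Qed.

Lemma nrm_fixg H a : nrm H a \in fixg H.
Proof. by apply/fixgP=> x; apply: gact_nrm. Qed.

Lemma nrm_aug H a : a \in aug H -> nrm H a = 0.
Proof.
pose F := zmod_morphism (raddfD (nrm H)).
suffices /subsetP sKer: aug H \subset 'ker F.
  by move/sKer; rewrite !inE => /eqP.
apply: aug_sub => x b Hx; rewrite !inE /= nrmB.
by rewrite nrm_gact ?(subsetP (normG H)) // gact_nrm // subrr.
Qed.

Lemma aug_stable H K : H \subset 'N(K) -> stable H (aug K).
Proof.
move=> nKH h a Hh; pose F := zmod_morphism (@gactD Q A h).
suffices /subsetP sK: aug K \subset (F @*^-1 (aug K))%G.
  by move/sK; rewrite !inE.
apply: aug_sub => x b Kx; rewrite !inE /= gactB -gactM.
have -> : (h * x = x ^ h^-1 * h)%g by rewrite conjgE invgK -!mulgA mulVg mulg1.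
by rewrite gactM mem_aug ?memJ_norm ?groupV ?(subsetP nKH).
Qed.

Lemma fixg_stable H K : H \subset 'N(K) -> stable H (fixg K).
Proof.
move=> nKH h a Hh /fixgP fa; apply/fixgP=> x Kx; rewrite -gactM.
have -> : (x * h = h * x ^ h)%g by rewrite conjgE mulKVg.
by rewrite gactM fa // memJ_norm ?(subsetP nKH).
Qed.

Lemma gdiff_gsum x n a : gdiff x (gsum x n a) = gdiff (x ^+ n)%g a.
Proof.
rewrite /gdiff /gsum gact_sum -sumrB.
under eq_bigr do rewrite -gactM -expgS.
elim: n => [|n IHn]; first by rewrite big_ord0 expg0 gact1 subrr.
by rewrite big_ord_recr IHn /= addrC addrA subrK.
Qed.

Lemma gsum_gdiff x n a : gsum x n (gdiff x a) = gdiff (x ^+ n)%g a.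
Proof.
rewrite -gdiff_gsum /gdiff gsumB [in RHS]/gsum gact_sum.
by congr (_ - _); apply: eq_bigr => i _; rewrite -!gactM -expgS -expgSr.
Qed.

End NormAug.

(** * Passing between a p-group and a maximal subgroup *)

Section MaximalSubgroup.

Variables (Q : finGroupType) (A : gmodule Q) (p : nat) (H K : {group Q}) (s : Q).
Hypotheses (p_pr : prime p) (pA : p.-group [set: A]) (pH : p.-group H).
Hypotheses (maxK : maximal K H) (Hs : s \in H) (nKs : s \notin K).

Let nsKH : K <| H := p_maximal_normal pH maxK.
Let nKH : H \subset 'N(K) := normal_norm nsKH.
Let sKH : K \subset H := normal_sub nsKH.
Let Ns : s \in 'N(K) := subsetP nKH s Hs.

Lemma order_coset_maximal : #[coset K s] = p.
Proof.
have dvd_p : (#[coset K s] %| p)%N.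
  rewrite -(p_maximal_index pH maxK) -card_quotient //.
  by rewrite order_dvdG ?mem_quotient.
have [_ /(_ _ dvd_p)/orP[|/eqP//]] := primeP p_pr.
by rewrite order_eq1 => /eqP /(coset_idr Ns); rewrite (negPf nKs).
Qed.

Lemma expg_maximal : (s ^+ p)%g \in K.
Proof.
apply: coset_idr; first exact: groupX.
by rewrite morphX // -order_coset_maximal expg_order.
Qed.

Let mul_sK (ik : 'I_p * Q) : Q := (s ^+ ik.1 * ik.2)%g.

Lemma maximal_imset :
  mul_sK @: setX [set: 'I_p] K = H
  /\ {in setX [set: 'I_p] K &, injective mul_sK}.
Proof.
have inj : {in setX [set: 'I_p] K &, injective mul_sK}.
  move=> [i k] [j l] /setXP[_ /= Kk] /setXP[_ /= Kl].
  rewrite /mul_sK /= => eq_ikjl.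
  have: coset K (s ^+ i * k)%g = coset K (s ^+ j * l)%g by rewrite eq_ikjl.
  rewrite !coset_kerr // !morphX // => /eqP; rewrite eq_expg_mod_order.
  rewrite order_coset_maximal !modn_small // => /eqP/val_inj eq_ij.
  by move: eq_ikjl; rewrite eq_ij => /mulgI ->.
split=> //; apply/eqP; rewrite eqEcard card_in_imset // cardsX cardsT card_ord.
rewrite -[X in (_ <= X * _)%N](p_maximal_index pH maxK) mulnC Lagrange //.
rewrite leqnn andbT.
apply/subsetP=> _ /imsetP[[i k] /setXP[_ /= Kk] ->].
by rewrite /mul_sK /= groupM ?groupX // (subsetP sKH).
Qed.

Lemma maximal_dec h : h \in H -> exists i k, k \in K /\ h = (s ^+ i * k)%g.
Proof.
rewrite -maximal_imset.1 => /imsetP[[i k] /setXP[_ Kk] ->].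
by exists i, k.
Qed.

Lemma nrm_maximal (a : A) : nrm H a = gsum s p (nrm K a).
Proof.
rewrite {1}/nrm -maximal_imset.1 (big_imset _ maximal_imset.2) /=.
under [RHS]eq_bigr do rewrite gact_sum.
rewrite pair_big /=; apply: eq_big => [[i k]|[i k] _] /=; last by rewrite gactM.
by rewrite !inE.
Qed.

Lemma nrm_gsum n (a : A) : nrm K (gsum s n a) = gsum s n (nrm K a).
Proof.
rewrite (raddf_sum (nrm K)); apply: eq_bigr => i _.
by rewrite [LHS]nrm_gact // groupX.
Qed.

Lemma gdiff_maximal (J : {group A}) (a : A) :
    stable H J -> gdiff s a \in J -> (forall k, k \in K -> gdiff k a \in J) ->
  forall h, h \in H -> gdiff h a \in J.
Proof.
move=> stJ Jsa JKa h /maximal_dec[i [k [Kk ->]]].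
have -> : gdiff (s ^+ i * k)%g a = gact (s ^+ i)%g (gdiff k a) + gdiff (s ^+ i)%g a.
  by rewrite /gdiff gactB -gactM addrA subrK.
apply: memgD; first by apply: stJ; [exact: groupX | exact: JKa].
rewrite -gdiff_gsum.
rewrite /gsum (raddf_sum (gdiff s)) memg_sum // => j _.
rewrite /= /gdiff -gactM -expgS expgSr gactM -gactB.
by rewrite stJ ?groupX.
Qed.

Lemma fixg_maximal a : a \in fixg A K -> gact s a = a -> a \in fixg A H.
Proof.
move=> /fixgP fKa fsa; apply/fixgP=> h Hh.
apply/eqP; rewrite -subr_eq0; apply/eqP/set1P.
apply: (@gdiff_maximal 1%G a _ _ _ h Hh).
- by move=> x y _ /set1P->; apply/set1P; apply: (raddf0 (gact x)).
- by rewrite /gdiff fsa subrr group1.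
by move=> k Kk; rewrite /gdiff fKa // subrr group1.
Qed.

Lemma gsum_fixg a : a \in fixg A K -> gsum s p a \in fixg A H.
Proof.
move=> fKa; apply: fixg_maximal.
  apply: memg_sum => i _; by apply: (fixg_stable nKH) => //; apply: groupX.
apply/eqP; rewrite -subr_eq0 [_ - _]gdiff_gsum /gdiff.
by rewrite (fixgP _ _ fKa) ?expg_maximal ?subrr.
Qed.

Section DegreeZero.

Hypothesis T0H : tate0 A H.

Lemma gsum_ker_fixg a : a \in fixg A K -> gsum s p a = 0 ->
  exists2 b, b \in fixg A K & a = gdiff s b.
Proof.
move=> fKa sa0.
have sub_fg w j : w \in fixg A K -> j \in (1%G : {group A}) ->
    gdiff s w + j \in fixg A K /\ gsum s p (gdiff s w + j) \in (1%G : {group A}).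
  move=> fKw /set1P->; rewrite addr0; split.
    by rewrite memgB ?(fixg_stable nKH).
  by rewrite gsum_gdiff /gdiff (fixgP _ _ fKw) ?expg_maximal ?subrr ?group1.
have sub_gf w : w \in fixg A K -> gdiff s w \in (1%G : {group A}) ->
    exists2 v, v \in fixg A K & w - gsum s p v \in (1%G : {group A}).
  move=> fKw /set1P sw.
  have [b ->] : exists b, w = nrm H b.
    by apply: T0H; apply: fixg_maximal => //; apply/eqP; rewrite -subr_eq0; apply/eqP.
  by exists (nrm K b); rewrite ?nrm_fixg // nrm_maximal subrr group1.
have [|b fKb /set1P/eqP] := herbrand sub_fg sub_gf fKa.
  exact/set1P.
by rewrite subr_eq0 => /eqP; exists b.
Qed.

Lemma tate0_maximal : tate0 A K.
Proof.
pose J : {group A} := (zmod_morphism (raddfD (nrm K)) @* setT)%G.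
have memJ b : nrm K b \in J by apply: mem_morphim; rewrite inE.
have JP b : b \in J -> exists c, b = nrm K c.
  by case/morphimP=> c _ _ ->; exists c.
have sJW : J \subset fixg_group A K.
  by apply/subsetP=> _ /JP[c ->]; apply: nrm_fixg.
suffices /subsetP sWJ : fixg_group A K \subset J by move=> a /sWJ/JP.
apply/idPn=> nsWJ.
have stJ : stable H J.
  move=> h _ Hh /JP[c ->]; rewrite -nrm_gact ?memJ //; exact: (subsetP nKH).
have [w [Ww nJw fw]] := fixed_coset p_pr pH (pgroupS (subsetT _) pA) sJW
  (fixg_stable nKH) stJ nsWJ.
have cover v : v \in fixg A K -> exists2 u, u \in fixg A K & v - gdiff s u \in J.
  move=> fKv; have [b eb] := T0H (gsum_fixg fKv).
  have [||u fKu eu] := gsum_ker_fixg (a := v - nrm K b).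
  - by rewrite memgB ?nrm_fixg.
  - by rewrite gsumB eb nrm_maximal subrr.
  by exists u => //; rewrite -eu opprB addrC subrK memJ.
case/negP: nJw; apply: (onto_mod_inj (f := gdiff s) sJW _ cover) => //.
  by move=> j Jj; apply: memgB => //; apply: stJ.
exact: fw.
Qed.

Lemma tateN1_maximal_up : tateN1 A K -> tateN1 A H.
Proof.
move=> TK a Na0; have [|b fKb eb] := gsum_ker_fixg (nrm_fixg K a).
  by rewrite -nrm_maximal.
have [c ec] := tate0_maximal fKb.
have sa : a - gdiff s c \in aug A K.
  by apply: TK; rewrite nrmB /gdiff nrmB nrm_gact // -ec eb subrr.
rewrite -[a](subrK (gdiff s c)); apply: memgD; last exact: mem_aug.
apply: subsetP sa; apply: aug_sub => x d Kx; apply: mem_aug.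
exact: (subsetP sKH).
Qed.

End DegreeZero.

Section DegreeMinusOne.

Hypothesis TmH : tateN1 A H.

Lemma aug_maximal (a : A) : a \in aug A H -> exists v, a - gdiff s v \in aug A K.
Proof.
pose I := [set b : A | [exists v, b - gdiff s v \in aug A K]].
have gI : group_set I.
  apply/group_setP; split=> [|b c].
    by rewrite inE; apply/existsP; exists 0; rewrite (raddf0 (gdiff s)) subrr group1.
  rewrite !inE => /existsP[v Jv] /existsP[w Jw]; apply/existsP; exists (v + w).
  by rewrite zmodMgE (raddfD (gdiff s)) opprD addrACA memgD.
have /subsetP sub : aug A H \subset Group gI.
  apply: aug_sub => h b /maximal_dec[i [k [Kk ->]]].
  rewrite inE; apply/existsP; exists (gsum s i b); rewrite gdiff_gsum /gdiff.
  rewrite opprB addrA subrK gactM -gactB; apply: (aug_stable nKH).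
    exact: groupX.
  exact: mem_aug.
by move/sub; rewrite inE => /existsP.
Qed.

Lemma gsum_aug (a : A) :
  gsum s p a \in aug A K -> exists v, a - gdiff s v \in aug A K.
Proof.
move=> Jsa; apply: aug_maximal; apply: TmH.
by rewrite nrm_maximal -nrm_gsum nrm_aug.
Qed.

Lemma gsum_stable (a : A) : a \in aug A K -> gsum s p a \in aug A K.
Proof.
by move=> Ja; apply: memg_sum => i _; apply: (aug_stable nKH) => //; apply: groupX.
Qed.

Lemma gdiff_ker_aug (a : A) :
  gdiff s a \in aug A K -> exists v, a - gsum s p v \in aug A K.
Proof.
move=> Jsa.
have sub_fg w j : w \in [set: A]%G -> j \in aug A K ->
    gsum s p w + j \in [set: A]%G /\ gdiff s (gsum s p w + j) \in aug A K.
  move=> _ Jj; split; first by rewrite inE.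
  rewrite (raddfD (gdiff s)) /= gdiff_gsum; apply: memgD.
    exact/mem_aug/expg_maximal.
  by apply: memgB => //; apply: (aug_stable nKH).
have sub_gf w : w \in [set: A]%G -> gsum s p w \in aug A K ->
    exists2 v, v \in [set: A]%G & w - gdiff s v \in aug A K.
  by move=> _ /gsum_aug[v Jv]; exists v; rewrite ?inE.
by have [v _ Jv] := herbrand sub_fg sub_gf (in_setT a) Jsa; exists v.
Qed.

Lemma tateN1_maximal : tateN1 A K.
Proof.
pose W : {group A} := ('ker (zmod_morphism (raddfD (nrm K))))%G.
have memW b : (b \in W) = (nrm K b == 0) by rewrite !inE.
have sJW : aug A K \subset W.
  by apply/subsetP=> b /nrm_aug Nb; rewrite memW Nb.
suffices /subsetP sWJ : W \subset aug A K.
  by move=> a Na; apply: sWJ; rewrite memW Na.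
apply/idPn=> nsWJ.
have stW : stable H W.
  move=> h b Hh; rewrite !memW nrm_gact ?(subsetP nKH) // => /eqP->.
  by rewrite (raddf0 (gact h)).
have [w [Ww nJw fw]] := fixed_coset p_pr pH (pgroupS (subsetT _) pA) sJW
  stW (aug_stable nKH) nsWJ.
have [v Jv] := gdiff_ker_aug (fw s Hs); case/negP: nJw.
have [u Ju] : exists u, v - gdiff s u \in aug A K.
  apply/aug_maximal/TmH; rewrite nrm_maximal -nrm_gsum.
  have /eqP Nw : nrm K w == 0 by rewrite -memW.
  by apply/eqP; have /eqP := nrm_aug Jv; rewrite nrmB Nw sub0r oppr_eq0.
rewrite -[w](subrK (gsum s p v)) memgD // -[v](subrK (gdiff s u)).
rewrite (raddfD (gsum s p)); apply: memgD; first exact: gsum_stable.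
rewrite /= gsum_gdiff.
exact/mem_aug/expg_maximal.
Qed.

Lemma tate0_maximal_up : tate0 A K -> tate0 A H.
Proof.
move=> TK a fHa; have [|b eb] := TK a.
  by apply/fixgP=> x /(subsetP sKH)/(fixgP _ _ fHa).
have [|v Jv] := @gdiff_ker_aug b.
  by apply: tateN1_maximal; rewrite nrmB nrm_gact // -eb (fixgP _ _ fHa) ?subrr.
exists v; rewrite nrm_maximal -nrm_gsum eb; apply/eqP.
by rewrite -subr_eq0 -nrmB nrm_aug.
Qed.

End DegreeMinusOne.

End MaximalSubgroup.

Section PGroup.

Variables (Q : finGroupType) (A : gmodule Q) (p : nat).
Hypotheses (p_pr : prime p) (pA : p.-group [set: A]).
Implicit Types (H K L : {group Q}).

Lemma tate0_sub H L : p.-group H -> L \subset H -> tate0 A H -> tate0 A L.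
Proof.
have [n] := ubnP #|H|; elim: n H => // n IHn H /ltnSE leHn pH sLH T0H.
have [eqLH | [K maxK sLK]] := maximal_exists sLH.
  by move=> a; rewrite /nrm eqLH; apply: T0H.
have ltKH := maxgroupp maxK; have [sKH [s Hs nKs]] := properP ltKH.
apply: (IHn K) (pgroupS sKH pH) sLK _.
  exact: leq_trans (proper_card ltKH) leHn.
exact: tate0_maximal p_pr pA pH maxK Hs nKs T0H.
Qed.

Lemma nrm1 (a : A) : nrm [1 Q]%G a = a.
Proof. by rewrite /nrm big_set1 gact1. Qed.

Lemma tate0_N1 H : p.-group H -> tate0 A H -> tateN1 A H.
Proof.
have [n] := ubnP #|H|; elim: n H => // n IHn H /ltnSE leHn pH T0H.
have [eqH1 | [K maxK _]] := maximal_exists (sub1G H).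
  move=> a; rewrite /nrm -eqH1 -/(nrm [1 Q]%G a) nrm1 => ->; exact: memg0.
have ltKH := maxgroupp maxK; have [sKH [s Hs nKs]] := properP ltKH.
apply: (tateN1_maximal_up p_pr pA pH maxK Hs nKs) => //.
apply: (IHn K) (pgroupS sKH pH) _.
  exact: leq_trans (proper_card ltKH) leHn.
exact: tate0_maximal p_pr pA pH maxK Hs nKs T0H.
Qed.

Lemma tateN1_0 H : p.-group H -> tateN1 A H -> tate0 A H.
Proof.
have [n] := ubnP #|H|; elim: n H => // n IHn H /ltnSE leHn pH TmH.
have [eqH1 | [K maxK _]] := maximal_exists (sub1G H).
  by move=> a _; exists a; rewrite /nrm -eqH1 -/(nrm [1 Q]%G a) nrm1.
have ltKH := maxgroupp maxK; have [sKH [s Hs nKs]] := properP ltKH.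
apply: (tate0_maximal_up p_pr pA pH maxK Hs nKs) => //.
apply: (IHn K) (pgroupS sKH pH) _.
  exact: leq_trans (proper_card ltKH) leHn.
exact: tateN1_maximal p_pr pA pH maxK Hs nKs TmH.
Qed.

Lemma fixg_neq0 H (a : A) : p.-group H -> a != 0 ->
  exists2 b, b \in fixg A H & b != 0.
Proof.
move=> pH nza.
have stT : stable H [set: A] by move=> h b _ _; rewrite inE.
have st1 : stable H [1 A]%G.
  by move=> h b _ /set1P->; apply/set1P; apply: (raddf0 (gact h)).
have nsT1 : ~~ ([set: A] \subset [1 A]%G).
  by apply/subsetPn; exists a; rewrite ?inE.
have [b [_ nzb fb]] := fixed_coset p_pr pH pA (sub1G _) stT st1 nsT1.
exists b; last by apply: contra nzb => /eqP->; apply: group1.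
by apply/fixgP=> h /fb/set1P/eqP; rewrite subr_eq0 => /eqP.
Qed.

End PGroup.

(** * Dimension shifting *)

HB.instance Definition _ (Q : finGroupType) (A : gmodule Q) n :=
  GRing.isZmodMorphism.Build (chain A n) (chain A n.+1) (@coboundary Q A n)
    (morphB_of_D (@coboundaryD Q A n)).

Section Tuples.

Variable Q : finGroupType.

Definition tcons n (g : Q) (s : {ffun 'I_n -> Q}) : {ffun 'I_n.+1 -> Q} :=
  [ffun i => if unlift ord0 i is Some j then s j else g].

Lemma tcons0 n g (s : {ffun 'I_n -> Q}) : tcons g s ord0 = g.
Proof. by rewrite ffunE unlift_none. Qed.

Lemma tconsS n g (s : {ffun 'I_n -> Q}) j : tcons g s (lift ord0 j) = s j.
Proof. by rewrite ffunE liftK. Qed.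

Lemma faceE n i (t : {ffun 'I_n.+1 -> Q}) (j : 'I_n) :
  face i t j = if (j.+1 < i)%N then t (widen_ord (leqnSn n) j) else
    if j.+1 == i then (t (widen_ord (leqnSn n) j) * t (lift ord0 j))%g
    else t (lift ord0 j).
Proof. by rewrite ffunE. Qed.

Lemma face0E n (t : {ffun 'I_n.+1 -> Q}) j : face ord0 t j = t (lift ord0 j).
Proof. by rewrite ffunE. Qed.

Lemma face0_tcons n g (s : {ffun 'I_n -> Q}) : face ord0 (tcons g s) = s.
Proof. by apply/ffunP=> j; rewrite face0E tconsS. Qed.

Lemma tcons_face0 n (t : {ffun 'I_n.+1 -> Q}) : tcons (t ord0) (face ord0 t) = t.
Proof.
apply/ffunP=> i; case: (unliftP ord0 i) => [j|] ->; last by rewrite tcons0.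
by rewrite tconsS face0E.
Qed.

Lemma tcons_bij n : bijective (fun gs : Q * {ffun 'I_n -> Q} => tcons gs.1 gs.2).
Proof.
exists (fun t : {ffun 'I_n.+1 -> Q} => (t ord0, face ord0 t)) => [[g s]|t] /=;
  last exact: tcons_face0.
by rewrite tcons0 face0_tcons.
Qed.

Lemma face1_tcons n g (u : {ffun 'I_n.+1 -> Q}) :
  face (lift ord0 ord0) (tcons g u) = tcons (g * u ord0)%g (face ord0 u).
Proof.
apply/ffunP=> i; case: (unliftP ord0 i) => [j|] ->.
  by rewrite tconsS face0E faceE /= tconsS.
rewrite tcons0 faceE /= tconsS; congr (_ * _)%g.
by rewrite (_ : widen_ord _ _ = ord0) ?tcons0 //; apply: val_inj.
Qed.

Lemma faceS_tcons n (i : 'I_n.+1) g (u : {ffun 'I_n.+1 -> Q}) :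
  face (lift ord0 (lift ord0 i)) (tcons g u) = tcons g (face (lift ord0 i) u).
Proof.
apply/ffunP=> k; case: (unliftP ord0 k) => [j|] ->.
  rewrite tconsS !faceE /= !tconsS.
  rewrite (_ : widen_ord _ _ = lift ord0 (widen_ord (leqnSn n) j)); last exact: val_inj.
  by rewrite tconsS /bump /= !add1n eqSS ltnS.
rewrite tcons0 faceE /=.
by rewrite (_ : widen_ord _ _ = ord0) ?tcons0 //; apply: val_inj.
Qed.

Lemma tuple0 (s t : {ffun 'I_0 -> Q}) : s = t.
Proof. by apply/ffunP=> - []. Qed.

End Tuples.

Lemma coboundary_tcons (Q : finGroupType) (A : gmodule Q) n (a : chain A n.+1) g
    (u : {ffun 'I_n.+1 -> Q}) :
  coboundary a (tcons g u) = gact g (a u) - a (tcons (g * u ord0)%g (face ord0 u))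
    + \sum_(i < n.+1) a (tcons g (face (lift ord0 i) u)) *~ (-1) ^+ i.+2.
Proof.
rewrite ffunE tcons0 face0_tcons big_ord_recl face1_tcons /= expr1 mulrN1z.
by rewrite addrA; congr (_ + _); apply: eq_bigr => i _; rewrite faceS_tcons.
Qed.

(* The shift map C^n(Q, {ffun Q -> A}) -> C^(n+1)(Q, A), also used on chains.  *)
Definition uncurry (Q : finGroupType) (A : gmodule Q) n
    (f : {ffun {ffun 'I_n -> Q} -> {ffun Q -> A}}) : chain A n.+1 :=
  [ffun t : {ffun 'I_n.+1 -> Q} => gact (t ord0) (f (face ord0 t) (t ord0)^-1%g)].

Lemma uncurry_tcons (Q : finGroupType) (A : gmodule Q) n
    (f : {ffun {ffun 'I_n -> Q} -> {ffun Q -> A}}) g s :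
  uncurry f (tcons g s) = gact g (f s g^-1%g).
Proof. by rewrite ffunE tcons0 face0_tcons. Qed.

Section ShiftUp.

Variables (Q : finGroupType) (A : gmodule Q).

(* The quotient of the coinduced module by A embedded as the constants, each   *)
(* class being represented by its function with value 0 at 1.                  *)
Definition up_pred : {pred {ffun Q -> A}} := fun phi => phi 1%g == 0.

Lemma up_zmod_closed : zmod_closed up_pred.
Proof.
split=> [|phi psi]; first by rewrite unfold_in ffunE.
by rewrite !unfold_in !ffunE => /eqP-> /eqP->; rewrite subrr.
Qed.

HB.instance Definition _ := GRing.isZmodClosed.Build _ up_pred up_zmod_closed.

Record up_sort := Up {up_val :> {ffun Q -> A}; up_valP : up_val \in up_pred}.

HB.instance Definition _ := [isSub for up_val].
HB.instance Definition _ := [Finite of up_sort by <:].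
HB.instance Definition _ := [SubChoice_isSubZmodule of up_sort by <:].

Lemma up1 (phi : up_sort) : phi 1%g = 0.
Proof. exact: eqP (up_valP phi). Qed.

Definition up_fun (x : Q) (phi : {ffun Q -> A}) : {ffun Q -> A} :=
  [ffun g => gact x (phi (x^-1 * g)%g) - gact x (phi x^-1%g)].

Lemma up_fun_subproof x phi : up_fun x phi \in up_pred.
Proof. by rewrite unfold_in ffunE mulg1 subrr. Qed.

Definition up_act x (phi : up_sort) : up_sort := Up (up_fun_subproof x phi).

Lemma up_actD x : {morph up_act x : a b / a + b}.
Proof.
move=> a b; apply/val_inj/ffunP=> g.
by rewrite /= !ffunE !gactD opprD addrACA.
Qed.

Lemma up_act1 a : up_act 1%g a = a.
Proof.
by apply/val_inj/ffunP=> g; rewrite ffunE !gact1 invg1 mul1g up1 subr0.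
Qed.

Lemma up_actM x y a : up_act (x * y)%g a = up_act x (up_act y a).
Proof.
apply/val_inj/ffunP=> g; rewrite !ffunE !gactB -!gactM invMg !mulgA.
by rewrite opprB addrA subrK.
Qed.

Definition up : gmodule Q := GModule up_actD up_act1 up_actM.

Lemma coboundary_uncurry n (f : {ffun {ffun 'I_n -> Q} -> {ffun Q -> A}}) g u :
  coboundary (uncurry f) (tcons g u) =
    - gact g (up_fun (u ord0) (f (face ord0 u)) g^-1%g
              + \sum_(i < n.+1) f (face (lift ord0 i) u) g^-1%g *~ (-1) ^+ i.+1).
Proof.
rewrite coboundary_tcons uncurry_tcons -{1}(tcons_face0 u) uncurry_tcons.
rewrite ffunE gactD gactB gact_sum invMg -!gactM opprD opprB; congr (_ + _).
rewrite -sumrN; apply: eq_bigr => i _.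
rewrite uncurry_tcons [in RHS](raddfMz (gact g)) /=.
by rewrite [in LHS]exprS mulN1r mulrNz.
Qed.

Definition up_eval (g : Q) (phi : up) : A := (phi : up_sort) g.

Lemma up_evalB g : {morph up_eval g : phi psi / phi - psi}.
Proof. by move=> phi psi; rewrite /up_eval [LHS]ffunE ffunE. Qed.

HB.instance Definition _ g :=
  GRing.isZmodMorphism.Build up A (up_eval g) (up_evalB g).

Lemma coboundary_up n (f : chain up n) g u :
  coboundary (uncurry [ffun s => f s : {ffun Q -> A}]) (tcons g u) =
    - gact g ((coboundary f u : {ffun Q -> A}) g^-1%g).
Proof.
rewrite coboundary_uncurry ffunE /=; congr (- gact g _).
rewrite !ffunE; congr (_ + _).
apply: etrans (esym (raddf_sum (up_eval _) _ _ _)); apply: eq_bigr => i _.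
by rewrite [RHS](raddfMz (up_eval _)) ffunE.
Qed.

Lemma sum_delta (F : Q -> A) c : \sum_(x in [set: Q]) F x *+ (x == c) = F c.
Proof.
rewrite (bigD1 c) ?inE //= eqxx mulr1n big1 ?addr0 // => x.
by case/andP=> _ /negPf->.
Qed.

(* If b is a primitive of the 1-cocycle of A attached to the invariant phi,    *)
(* then phi g = b - g b is the norm of the function g |-> b - [g = 1] b.       *)
Lemma tate0_up : (forall f : chain A 1, coboundary f = 0 ->
    exists e, f = coboundary e) -> tate0 up [set: Q]%G.
Proof.
move=> H1 phi /fixgP fphi.
pose f : chain up 0 := [ffun=> phi].
have df0 : coboundary f = 0.
  apply/ffunP=> t; rewrite !ffunE big_ord_recl big_ord0 !ffunE fphi ?inE //.
  by rewrite addr0 expr1 mulrN1z subrr.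
have da0 : coboundary (uncurry [ffun s => f s : {ffun Q -> A}]) = 0.
  apply/ffunP=> t; rewrite -[t]tcons_face0 coboundary_up df0 !ffunE.
  by rewrite (raddf0 (gact _)) oppr0.
have [e ae] := H1 _ da0.
pose b := e [ffun i : 'I_0 => 1%g].
have eb t : e t = b by congr (e _); apply: tuple0.
have phiE g : phi g = b - gact g b.
  have /ffunP/(_ (tcons g^-1%g [ffun i => 1%g])) := ae.
  rewrite uncurry_tcons invgK !ffunE unlift_none big_ord_recl big_ord0 !eb.
  rewrite addr0 expr1 mulrN1z => /(congr1 (gact g)).
  by rewrite gactB -!gactM mulgV !gact1.
have upsi : [ffun g => b - b *+ (g == 1%g)] \in up_pred.
  by rewrite unfold_in ffunE eqxx subrr.
exists (Up upsi); apply/val_inj/ffunP=> g; rewrite phiE /nrm.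
rewrite [RHS](raddf_sum (up_eval g)) /up_eval /=.
transitivity (\sum_(x in [set: Q]) gact x b *+ (x == 1%g)
              - \sum_(x in [set: Q]) gact x b *+ (x == g)).
  by rewrite !(sum_delta (fun x => gact x b)) gact1.
rewrite -sumrB; apply: eq_bigr => x _.
rewrite /up_eval !ffunE /= !gactB opprB [RHS]addrC addrA subrK.
by rewrite -eq_mulVg1 invg_eq1 !(raddfMn (gact x)).
Qed.

Lemma coboundary_exact_up n : (forall f : chain A n.+2, coboundary f = 0 ->
    exists e, f = coboundary e) ->
  forall f : chain up n.+1, coboundary f = 0 -> exists e, f = coboundary e.
Proof.
move=> Hn f df0.
have da0 : coboundary (uncurry [ffun s => f s : {ffun Q -> A}]) = 0.
  apply/ffunP=> t; rewrite -[t]tcons_face0 coboundary_up df0 !ffunE.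
  by rewrite (raddf0 (gact _)) oppr0.
have [b ab] := Hn _ da0.
(* Normalizing b at g = 1 only changes it by a cocycle. *)
pose e1 (s : {ffun 'I_n -> Q}) : {ffun Q -> A} :=
  [ffun g : Q => gact g (b (tcons g^-1%g s)) - b (tcons 1%g s)].
have ue1 s : e1 s \in up_pred.
  by rewrite unfold_in ffunE gact1 invg1 subrr.
pose e : chain up n := [ffun s => Up (ue1 s)].
pose c : chain A n.+1 := uncurry [ffun s => [ffun=> b (tcons 1%g s)]].
pose kappa (u : {ffun 'I_n.+1 -> Q}) :=
  \sum_(i < n.+1) b (tcons 1%g (face (lift ord0 i) u)) *~ (-1) ^+ i.+1.
have dc g u : coboundary c (tcons g u) = - gact g (kappa u).
  rewrite coboundary_uncurry !ffunE subrr add0r.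
  by congr (- gact g _); apply: eq_bigr => i _; rewrite !ffunE.
have be : b = uncurry [ffun s => e s : {ffun Q -> A}] + c.
  apply/ffunP=> t; rewrite -[t]tcons_face0 ffunE !uncurry_tcons !ffunE invgK.
  by rewrite -gactD subrK -gactM mulgV gact1.
have fe g u : gact g (f u g^-1%g) = - gact g (coboundary e u g^-1%g) - gact g (kappa u).
  rewrite -dc -coboundary_up; have /ffunP/(_ (tcons g u)) := ab.
  by rewrite uncurry_tcons ffunE {1}be coboundaryD ffunE.
have kappa0 u : kappa u = 0.
  have := fe 1%g u; rewrite invg1 !gact1 !up1 oppr0 sub0r => /eqP.
  by rewrite eq_sym oppr_eq0 => /eqP.
exists (- e); rewrite raddfN /=; apply/ffunP=> u; apply/val_inj/ffunP=> h.
have := fe h^-1%g u; rewrite kappa0 (raddf0 (gact _)) subr0 invgK => /(congr1 (gact h)).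
rewrite (raddfN (gact h)) /= -!gactM mulgV !gact1 => fuh.
have -> : (- coboundary e : chain up n.+1) u = - coboundary e u by rewrite ffunE.
by rewrite -[RHS]/(up_eval h (- coboundary e u)) raddfN.
Qed.

Lemma tate0_of_up : tateN1 up [set: Q]%G -> tate0 A [set: Q]%G.
Proof.
move=> Tup a /fixgP fa.
have uphi : [ffun g : Q => a *+ (g == 1%g) - a] \in up_pred.
  by rewrite unfold_in ffunE eqxx subrr.
have Nphi : nrm [set: Q] (Up uphi : up) = 0.
  apply/val_inj/ffunP=> g; rewrite /nrm.
  transitivity (\sum_(x in [set: Q]) (gact x a *+ (x == g) - gact x a *+ (x == 1%g))).
    rewrite [LHS](raddf_sum (up_eval g)); apply: eq_bigr => x _.
    rewrite /= /up_eval !ffunE /= !gactB opprB addrA subrK.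
    by rewrite -eq_mulVg1 invg_eq1 !(raddfMn (gact x)).
  by rewrite sumrB !(sum_delta (fun x => gact x a)) !fa ?inE // subrr ffunE.
pose tau (phi : up) : A := \sum_(y in [set: Q]) gact y^-1%g ((phi : up_sort) y).
have tauB : {morph tau : phi psi / phi - psi}.
  move=> phi psi; rewrite /tau -sumrB; apply: eq_bigr => y _.
  by rewrite -gactB [X in gact _ X = _](up_evalB y).
have nrmV (c : A) : \sum_(y in [set: Q]) gact y^-1%g c = nrm [set: Q] c.
  by rewrite /nrm [RHS](reindex_inj invg_inj); apply: eq_bigl => y; rewrite !inE.
pose B := [set phi : up | [exists b, tau phi == nrm [set: Q] b]].
have gB : group_set B.
  apply/group_setP; split=> [|phi psi].
    rewrite inE; apply/existsP; exists 0; rewrite (raddf0 (nrm _)).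
    by rewrite -[X in tau X](subrr 0) tauB subrr.
  rewrite !inE => /existsP[b /eqP eb] /existsP[c /eqP ec].
  apply/existsP; exists (b + c); rewrite -[psi]opprK -[- psi]sub0r.
  rewrite zmodMgE !tauB eb ec -[X in tau X](subrr 0) tauB subrr sub0r opprK.
  by rewrite (raddfD (nrm _)).
have /subsetP sB : aug up [set: Q] \subset Group gB.
  apply: aug_sub => x psi _; rewrite inE; apply/existsP.
  exists (- gact x ((psi : up_sort) x^-1%g)); rewrite tauB.
  rewrite (raddfN (nrm _)) /= -nrmV.
  suffices -> : tau psi = tau (gact x psi)
      + \sum_(y in [set: Q]) gact y^-1%g (gact x ((psi : up_sort) x^-1%g)).
    by rewrite opprD addrA subrr sub0r.
  rewrite /tau [LHS](reindex_inj (mulgI x^-1%g)) -big_split /=.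
  apply: eq_big => [y|y _]; first by rewrite !inE.
  by rewrite ffunE -gactD subrK -gactM invMg invgK.
have := sB _ (Tup _ Nphi); rewrite inE => /existsP[b /eqP].
rewrite /tau; under eq_bigr do rewrite /= ffunE gactB (raddfMn (gact _)).
rewrite sumrB (sum_delta (fun x => gact x^-1%g a)) invg1 gact1 nrmV => eb.
by exists (a + b); rewrite (raddfD (nrm _)) /= -eb addrC subrK.
Qed.

End ShiftUp.

HB.instance Definition _ (Q : finGroupType) (A : gmodule Q) n :=
  GRing.isZmodMorphism.Build (chain A n.+1) (chain A n) (@boundary Q A n)
    (morphB_of_D (@boundaryD Q A n)).

Lemma sum_tcons (Q : finGroupType) (V : nmodType) n (P : pred {ffun 'I_n.+1 -> Q}) F :
  \sum_(t | P t) F t = \sum_g \sum_(s | P (tcons g s)) F (tcons g s) :> V.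
Proof. by rewrite (reindex _ (onW_bij _ (tcons_bij Q n))) pair_big_dep. Qed.

Lemma eq_tcons (Q : finGroupType) n (g h : Q) (s t : {ffun 'I_n -> Q}) :
  (tcons g s == tcons h t) = (g == h) && (s == t).
Proof.
apply/eqP/andP=> [eq_gs|[/eqP-> /eqP->]//].
have /ffunP/(_ ord0) := eq_gs; rewrite !tcons0 => ->.
by have := congr1 (face ord0) eq_gs; rewrite !face0_tcons => ->; rewrite !eqxx.
Qed.

Section ShiftDown.

Variables (Q : finGroupType) (A : gmodule Q).

(* The kernel of the summation map from the induced module to A.               *)
Definition down_pred : {pred {ffun Q -> A}} := fun phi => \sum_g phi g == 0.

Lemma down_zmod_closed : zmod_closed down_pred.
Proof.
split=> [|phi psi]; rewrite !unfold_in.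
  by rewrite big1 // => g _; rewrite ffunE.
move=> /eqP phi0 /eqP psi0.
under eq_bigr do rewrite !ffunE.
by rewrite sumrB phi0 psi0 subrr.
Qed.

HB.instance Definition _ := GRing.isZmodClosed.Build _ down_pred down_zmod_closed.

Record down_sort := Down {down_val :> {ffun Q -> A}; down_valP : down_val \in down_pred}.

HB.instance Definition _ := [isSub for down_val].
HB.instance Definition _ := [Finite of down_sort by <:].
HB.instance Definition _ := [SubChoice_isSubZmodule of down_sort by <:].

Lemma down_sum (phi : down_sort) : \sum_g phi g = 0.
Proof. exact: eqP (down_valP phi). Qed.

Definition down_fun (x : Q) (phi : {ffun Q -> A}) : {ffun Q -> A} :=
  [ffun g => gact x (phi (x^-1 * g)%g)].

Lemma down_fun_subproof x (phi : down_sort) : down_fun x phi \in down_pred.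
Proof.
rewrite unfold_in (reindex_inj (mulgI x)) /=.
under eq_bigr do rewrite ffunE mulKg.
by rewrite -gact_sum down_sum (raddf0 (gact x)).
Qed.

Definition down_act x (phi : down_sort) : down_sort := Down (down_fun_subproof x phi).

Lemma down_actD x : {morph down_act x : a b / a + b}.
Proof. by move=> a b; apply/val_inj/ffunP=> g; rewrite /= !ffunE !gactD. Qed.

Lemma down_act1 a : down_act 1%g a = a.
Proof. by apply/val_inj/ffunP=> g; rewrite ffunE !gact1 invg1 mul1g. Qed.

Lemma down_actM x y a : down_act (x * y)%g a = down_act x (down_act y a).
Proof. by apply/val_inj/ffunP=> g; rewrite !ffunE -!gactM invMg !mulgA. Qed.

Definition down : gmodule Q := GModule down_actD down_act1 down_actM.

Definition down_eval (g : Q) (phi : down) : A := (phi : down_sort) g.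

Lemma down_evalB g : {morph down_eval g : phi psi / phi - psi}.
Proof. by move=> phi psi; rewrite /down_eval [LHS]ffunE ffunE. Qed.

HB.instance Definition _ g :=
  GRing.isZmodMorphism.Build down A (down_eval g) (down_evalB g).

Lemma boundary_uncurry n (c : {ffun {ffun 'I_n.+1 -> Q} -> {ffun Q -> A}}) g s :
  boundary (uncurry c) (tcons g s) = \sum_x c (tcons g s) x
    - gact g (\sum_(u | face ord0 u == s) down_fun (u ord0)^-1%g (c u) g^-1%g
      + \sum_(i < n.+1) \sum_(u | face (lift ord0 i) u == s)
          c u g^-1%g *~ (-1) ^+ i.+1).
Proof.
rewrite ffunE big_ord_recl /= addrA gactD opprD addrA; congr (_ + _ + _).
- rewrite sum_tcons (reindex_inj invg_inj); apply: eq_bigr => x _.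
  rewrite (big_pred1 (tcons g s)) => [|u]; last by rewrite /= face0_tcons.
  by rewrite uncurry_tcons tcons0 -gactM mulVg gact1 invgK.
- rewrite sum_tcons (exchange_big_dep (fun u => face ord0 u == s)) /=; last first.
    by move=> x u _; rewrite face1_tcons eq_tcons => /andP[].
  rewrite gact_sum -sumrN; apply: eq_bigr => u us.
  rewrite (big_pred1 (g * (u ord0)^-1)%g) => [|x]; last first.
    by rewrite /= face1_tcons eq_tcons us andbT -(can_eq (mulgK (u ord0)^-1%g)) mulgK.
  by rewrite uncurry_tcons expr1 mulrN1z ffunE -gactM invMg !invgK.
rewrite gact_sum -sumrN; apply: eq_bigr => i _.
rewrite sum_tcons (exchange_big_dep (fun u => face (lift ord0 i) u == s)) /=; last first.
  by move=> x u _; rewrite faceS_tcons eq_tcons => /andP[].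
rewrite gact_sum -sumrN; apply: eq_bigr => u us.
rewrite (big_pred1 g) => [|x]; last by rewrite /= faceS_tcons eq_tcons us andbT.
by rewrite uncurry_tcons [in LHS]exprS mulN1r mulrNz (raddfMz (gact g)).
Qed.

Lemma boundary_eval n (c : chain down n.+1) s h :
  down_eval h (boundary c s) =
    \sum_(u | face ord0 u == s) down_fun (u ord0)^-1%g (c u : down_sort) h
    + \sum_(i < n.+1) \sum_(u | face (lift ord0 i) u == s)
        down_eval h (c u) *~ (-1) ^+ i.+1.
Proof.
rewrite ffunE (raddfD (down_eval h)) !(raddf_sum (down_eval h)); congr (_ + _).
apply: eq_bigr => i _; rewrite (raddf_sum (down_eval h)); apply: eq_bigr => u _.
by rewrite (raddfMz (down_eval h)).
Qed.

Lemma boundary_down n (c : chain down n.+1) g s :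
  boundary (uncurry [ffun u => c u : {ffun Q -> A}]) (tcons g s) =
    - gact g (down_eval g^-1%g (boundary c s)).
Proof.
rewrite boundary_uncurry ffunE down_sum sub0r boundary_eval.
congr (- gact g (_ + _)); first by apply: eq_bigr => u _; rewrite !ffunE.
by apply: eq_bigr => i _; apply: eq_bigr => u _; rewrite ffunE.
Qed.

Lemma boundary_lift_down n (c : chain down n) (b : chain A n.+2) :
  uncurry [ffun u => c u : {ffun Q -> A}] = boundary b -> exists e, c = boundary e.
Proof.
move=> cb.
pose S (u : {ffun 'I_n.+1 -> Q}) := \sum_g gact g (b (tcons g^-1%g u)).
pose e1 u : {ffun Q -> A} :=
  [ffun g : Q => gact g (b (tcons g^-1%g u)) - S u *+ (g == 1%g)].
have sum1 (a : A) : \sum_(g : Q) a *+ (g == 1%g) = a.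
  by rewrite (bigD1 1%g) //= eqxx big1 ?addr0 // => g /negPf->.
have de1 u : e1 u \in down_pred.
  by rewrite unfold_in; under eq_bigr do rewrite ffunE; rewrite sumrB sum1 subrr.
pose e : chain down n.+1 := [ffun u => Down (de1 u)].
pose d : chain A n.+2 := uncurry [ffun u => [ffun g => S u *+ (g == 1%g)]].
have be : b = uncurry [ffun u => e u : {ffun Q -> A}] + d.
  apply/ffunP=> t; rewrite -[t]tcons_face0 ffunE !uncurry_tcons !ffunE invgK.
  by rewrite -gactD subrK -gactM mulgV gact1.
pose R (s : {ffun 'I_n -> Q}) : A := \sum_(i < n.+1)
  \sum_(u | face (lift ord0 i) u == s) S u *~ (-1) ^+ i.+1.
have dd g s : boundary d (tcons g s) = - gact g (R s *+ (g == 1%g)).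
  rewrite boundary_uncurry ffunE; under eq_bigr do rewrite ffunE.
  rewrite sum1 gactD opprD addrA.
  rewrite sum_tcons (bigD1 g) //= [X in gact g (_ + X)]big1 => [|x neq_xg].
    rewrite (big_pred1 s) => [|u]; last by rewrite /= face0_tcons.
    rewrite tcons0 !ffunE invgK mulgV eqxx addr0 -gactM mulgV gact1 subrr sub0r.
    congr (- gact g _); rewrite -sumrMnl; apply: eq_bigr => i _.
    rewrite -sumrMnl; apply: eq_bigr => u _.
    by rewrite !ffunE invg_eq1 !pmulrn mulrzAC.
  apply: big1 => u _; rewrite tcons0 !ffunE invgK -eq_mulgV1 (negPf neq_xg).
  exact: (raddf0 (gact _)).
have cE s h : down_eval h (c s) = - down_eval h (boundary e s) - R s *+ (h == 1%g).
  have /ffunP/(_ (tcons h^-1%g s))/(congr1 (gact h)) := cb.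
  rewrite uncurry_tcons ffunE invgK -gactM mulgV gact1 be boundaryD ffunE.
  rewrite boundary_down dd gactD !(raddfN (gact _)) /= -!gactM mulgV !gact1 invgK.
  by rewrite invg_eq1.
have R0 s : R s = 0.
  have : \sum_h down_eval h (c s) = 0 by apply: down_sum.
  under eq_bigr do rewrite cE; rewrite sumrB sum1 sumrN [X in - X](down_sum _).
  by rewrite oppr0 sub0r => /eqP; rewrite oppr_eq0 => /eqP.
exists (- e); rewrite raddfN /=; apply/ffunP=> s; apply/val_inj/ffunP=> h.
have := cE s h; rewrite R0 mul0rn subr0 => csh.
have -> : (- boundary e : chain down n) s = - boundary e s by rewrite ffunE.
by rewrite -[RHS]/(down_eval h (- boundary e s)) raddfN.
Qed.

Lemma boundary_exact_down n : (forall c : chain A n.+2, boundary c = 0 ->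
    exists e, c = boundary e) ->
  forall c : chain down n.+1, boundary c = 0 -> exists e, c = boundary e.
Proof.
move=> Hn c dc0; have [|b cb] := Hn (uncurry [ffun u => c u : {ffun Q -> A}]).
  apply/ffunP=> t; rewrite -[t]tcons_face0 boundary_down dc0 !ffunE.
  by rewrite (raddf0 (down_eval _)) (raddf0 (gact _)) oppr0.
exact: boundary_lift_down cb.
Qed.

Lemma norm_exact_down : (forall c : chain A 1, boundary c = 0 ->
    exists e, c = boundary e) ->
  forall c : chain down 0, norm c = 0 -> exists e, c = boundary e.
Proof.
move=> H1 c Nc0; have [|b cb] := H1 (uncurry [ffun u => c u : {ffun Q -> A}]).
  apply/ffunP=> s; rewrite ffunE big_ord_recl big_ord0 !sum_tcons !ffunE addr0.
  have pred1s (P : pred {ffun 'I_0 -> Q}) (F : {ffun 'I_0 -> Q} -> A) :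
      P s -> \sum_(u | P u) F u = F s.
    by move=> Ps; apply: big_pred1 => u; rewrite /= (tuple0 u s) Ps eqxx.
  rewrite [X in X + _](_ : _ = 0) ?add0r; last first.
    rewrite -[RHS](down_sum (c s)) [RHS](reindex_inj invg_inj) /=.
    apply: eq_bigr => g _; rewrite pred1s; last exact/eqP/tuple0.
    by rewrite tcons0 uncurry_tcons ffunE -gactM mulVg gact1.
  transitivity (- down_eval 1%g (norm c s)); last first.
    by rewrite Nc0 ffunE (raddf0 (down_eval _)) oppr0.
  rewrite ffunE (raddf_sum (down_eval _)) -sumrN. apply: eq_bigr => g _.
  rewrite pred1s; last exact/eqP/tuple0.
  by rewrite uncurry_tcons expr1 mulrN1z /= /down_eval !ffunE mulg1.
exact: boundary_lift_down cb.
Qed.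

Lemma tateN1_of_down : tate0 down [set: Q]%G -> tateN1 A [set: Q]%G.
Proof.
move=> T0 a Na0.
have da : [ffun g => gact g a] \in down_pred.
  rewrite unfold_in; under eq_bigr do rewrite ffunE.
  by apply/eqP; rewrite -[RHS]Na0 /nrm; apply: eq_bigl => x; rewrite inE.
have [|phi ephi] := T0 (Down da).
  apply/fixgP=> x _; apply/val_inj/ffunP=> g.
  by rewrite /= !ffunE -gactM mulKVg.
have := congr1 (down_eval 1%g) ephi; rewrite /nrm (raddf_sum (down_eval 1%g)).
rewrite [LHS]ffunE gact1 => ->.
have -> : \sum_(x in [set: Q]) down_eval 1%g (gact x phi)
    = \sum_(x in [set: Q]) gdiff x ((phi : down_sort) x^-1%g).
  rewrite sumrB [X in _ - X](_ : _ = 0) ?subr0; last first.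
    rewrite -[RHS](down_sum phi) [RHS](reindex_inj invg_inj).
    by apply: eq_bigl => x; rewrite inE.
  by apply: eq_bigr => x _; rewrite /= /down_eval ffunE mulg1.
by apply: memg_sum => x Qx; apply: mem_aug.
Qed.

End ShiftDown.

Lemma pgroup_zmodP (p : nat) (V : finZmodType) : prime p ->
  reflect (exists k, forall v : V, v *+ p ^ k = 0) (p.-group [set: V]).
Proof.
move=> p_pr; apply: (iffP idP) => [/p_natP[k oV]|[k Vk0]].
  by exists k => v; rewrite -oV -zmodXgE expg_cardG ?inE.
rewrite -pnat_exponent; apply: (@pnat_dvd _ (p ^ k)); last by rewrite pnatX pnat_id.
by apply/exponentP=> v _; rewrite zmodXgE Vk0.
Qed.

Section CohomologicalTriviality.

Variables (p : nat) (Q : finGroupType).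
Hypotheses (p_pr : prime p) (pQ : p.-group [set: Q]).
Implicit Types A : gmodule Q.

Lemma pgroup_up A : p.-group [set: A] -> p.-group [set: up A].
Proof.
case/(pgroup_zmodP _ p_pr)=> k Ak0; apply/(pgroup_zmodP _ p_pr); exists k => phi.
apply/val_inj/ffunP=> g.
by rewrite -[LHS]/(up_eval g (phi *+ p ^ k)) raddfMn /= Ak0 [RHS]ffunE.
Qed.

Lemma pgroup_down A : p.-group [set: A] -> p.-group [set: down A].
Proof.
case/(pgroup_zmodP _ p_pr)=> k Ak0; apply/(pgroup_zmodP _ p_pr); exists k => phi.
apply/val_inj/ffunP=> g.
by rewrite -[LHS]/(down_eval g (phi *+ p ^ k)) raddfMn /= Ak0 [RHS]ffunE.
Qed.

Lemma tate0_of_cocycles n A : p.-group [set: A] ->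
    (forall f : chain A n.+1, coboundary f = 0 -> exists e, f = coboundary e) ->
  tate0 A [set: Q]%G.
Proof.
elim: n A => [|n IHn] A pA Hn; apply: tate0_of_up;
  apply: (tate0_N1 p_pr (pgroup_up pA) pQ).
  exact: tate0_up.
apply: IHn; first exact: pgroup_up.
exact: coboundary_exact_up.
Qed.

Lemma tateN1_of_norm A :
    (forall c : chain A 0, norm c = 0 -> exists e, c = boundary e) ->
  tateN1 A [set: Q]%G.
Proof.
move=> H0 a Na0; pose o : {ffun 'I_0 -> Q} := [ffun=> 1%g].
have [|e /ffunP/(_ o)] := H0 [ffun=> a].
  apply/ffunP=> t; rewrite !ffunE -[RHS]Na0 /nrm.
  by apply: eq_big => [x|x _]; rewrite ?inE // ffunE.
rewrite !ffunE => ->; rewrite big_ord_recl big_ord0 addr0 expr1.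
have face_o i (t : {ffun 'I_1 -> Q}) : (face i t == o) = true.
  exact/eqP/tuple0.
rewrite (eq_bigl xpredT) => [|t]; last exact: face_o.
rewrite [X in _ + X](eq_bigl xpredT) => [|t]; last exact: face_o.
rewrite -big_split memg_sum // => t _ /=; rewrite mulrN1z.
by apply: (@mem_aug Q A [set: Q]); rewrite inE.
Qed.

Lemma tateN1_of_cycles n A : p.-group [set: A] ->
    (forall c : chain A n.+1, boundary c = 0 -> exists e, c = boundary e) ->
  tateN1 A [set: Q]%G.
Proof.
elim: n A => [|n IHn] A pA Hn; apply: tateN1_of_down;
  apply: (tateN1_0 p_pr (pgroup_down pA) pQ).
  exact/tateN1_of_norm/norm_exact_down.
apply: IHn; first exact: pgroup_down.
exact: boundary_exact_down.
Qed.

Lemma cocycles_sub (A : gmodule Q) n : tate_cohomology A n :=: 1%g ->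
  tate_cocycles A n \subset tate_coboundaries A n.
Proof.
move=> H1; have eqH : (tate_cocycles A n / tate_coboundaries A n)%g = 1%g := H1.
rewrite -quotient_sub1 ?eqH //.
apply: subset_trans (subsetT _) _; apply: sub_abelian_norm (subsetT _).
exact: zmod_abelian.
Qed.

Lemma tate0_of_tate_cohomology A n : p.-group [set: A] ->
  tate_cohomology A n :=: 1%g -> tate0 A [set: Q]%G.
Proof.
move=> pA /cocycles_sub/subsetP; case: n => [[|n]|n] sub.
- move=> a /fixgP fa; pose o : {ffun 'I_0 -> Q} := [ffun=> 1%g].
  have /sub/morphimP[e _ _ /ffunP/(_ o)] : [ffun=> a] \in tate_cocycles A 0.
    rewrite !inE; apply/eqP/ffunP=> t; rewrite !ffunE big_ord_recl big_ord0 ffunE.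
    by rewrite fa ?inE // addr0 expr1 mulrN1z subrr.
  rewrite !ffunE => ->; exists (e o).
  by rewrite /nrm; apply: eq_bigl => x; rewrite inE.
- apply: (tate0_of_cocycles (n := n)) => // f df0.
  have /sub/morphimP[e _ _ ->] : f \in tate_cocycles A n.+1 by rewrite !inE /= df0.
  by exists e.
apply: (tateN1_0 p_pr pA pQ); case: n sub => [|n] sub.
  apply: tateN1_of_norm => c Nc0.
  have /sub/morphimP[e _ _ ->] : c \in tate_cocycles A (Negz 0) by rewrite !inE /= Nc0.
  by exists e.
apply: (tateN1_of_cycles (n := n)) => // c dc0.
have /sub/morphimP[e _ _ ->] : c \in tate_cocycles A (Negz n.+1).
  by rewrite !inE /= dc0.
by exists e.
Qed.

End CohomologicalTriviality.

(** * Centers of normal subgroups of semi-abelian groups *)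

Lemma exists_commuting_pair (p : nat) (gT : finGroupType) (H : {group gT}) :
    prime p -> p.-group H -> ~~ cyclic H -> ~ generalized_quaternion H ->
  exists x y, [/\ x \in H, y \in H, #[x] = p, #[y] = p
    & commute x y /\ y \notin <[x]>]%g.
Proof.
move=> p_pr pH ncH nqH.
have ntH : (H :!=: 1)%g by apply: contra ncH => /eqP->; apply: cyclic1.
have [x Zx ox] : exists2 x, x \in 'Z(H)%g & #[x]%g = p.
  have pZ : p.-group 'Z(H)%g := pgroupS (center_sub H) pH.
  have [|_ pdvZ _] := pgroup_pdiv pZ.
    by rewrite center_nil_eq1 ?(pgroup_nil pH).
  by have [x] := Cauchy p_pr pdvZ; exists x.
have [Hx cHx] := centerP _ _ Zx.
have ohm_p : #|'Ohm_1(H)%g| <> p.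
  move/(prime_Ohm1P pH ntH); rewrite (negPf ncH) => /andP[_ /eqP].
  by move/quaternion_classP.
have /subsetPn[y] : ~~ ([set y in H | prime #[y]%g] \subset <[x]>%g).
  apply: contra_notN ohm_p => sub; rewrite -ox orderE; congr #|pred_of_set _|.
  apply/eqP; rewrite eqEsubset Ohm1Eprime.
  by rewrite !gen_subG sub sub1set mem_gen // inE Hx ox.
rewrite inE => /andP[Hy pr_y] nxy; have oy : #[y]%g = p.
  exact/eqP/(pgroupP pH _ pr_y)/order_dvdG.
by exists x, y; split=> //; split=> //; apply: cHx.
Qed.

Section RankTwo.

Variables (p : nat) (Q : finGroupType) (A : gmodule Q) (x y : Q).
Hypotheses (p_pr : prime p) (ox : #[x]%g = p) (oy : #[y]%g = p).
Hypotheses (cxy : commute x y) (nxy : y \notin <[x]>%g).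

Let E := (<[x]> <*> <[y]>)%G.

Lemma rank2E : E = (<[x]> * <[y]>)%g :> {set Q}.
Proof. rewrite /= cent_joinEr //= cent_cycle cycle_subG. exact/cent1P. Qed.

Lemma card_rank2 : #|E| = (p * p)%N.
Proof.
rewrite rank2E TI_cardMg -?orderE ?ox ?oy // setIC.
by rewrite prime_TIg ?cycle_subG // -orderE oy.
Qed.

Lemma rank2_expg e : e \in E -> (e ^+ p = 1)%g.
Proof.
rewrite rank2E => /mulsgP[_ _ /cycleP[i ->] /cycleP[j ->] ->].
rewrite expgMn; last by apply: commuteX2.
by rewrite -!expgM mulnC [(j * p)%N]mulnC !expgM -{1}ox -oy !expg_order !expg1n mulg1.
Qed.

Lemma nrm_cycle (a : A) : nrm <[x]>%g a = gsum x p a.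
Proof.
have pX : p.-group <[x]>%g by rewrite /pgroup -orderE ox pnat_id.
have max1 : maximal 1%g <[x]>%g.
  by apply: p_index_maximal; rewrite ?sub1G // indexg1 -orderE ox.
rewrite (nrm_maximal p_pr pX max1 (cycle_id x)) ?nrm1 //.
by apply/set1P=> x1; move: p_pr; rewrite -ox x1 order1.
Qed.

Lemma nrm_rank2 (a : A) : nrm E a = gsum y p (gsum x p a).
Proof.
have pE : p.-group E by rewrite /pgroup card_rank2 pnatM pnat_id.
have sXE : <[x]>%g \subset E by apply: joing_subl.
have maxX : maximal <[x]>%g E.
  apply: p_index_maximal => //; rewrite -divgS // card_rank2 -orderE ox.
  by rewrite mulnK ?prime_gt0.
rewrite (nrm_maximal p_pr pE maxX _ nxy) ?nrm_cycle //.
by apply: (subsetP (joing_subr _ _)); apply: cycle_id.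
Qed.

Hypothesis gsum0 : forall q (a : A), gsum q p a = 0 <-> a *+ p = 0.

(* Since ker N_x = ker N_y = A[p] contains the augmentation part of A, the     *)
(* vanishing in degree -1 makes N_x A meet A[p] trivially.  So N_x = 0, hence  *)
(* N_E = 0, and the vanishing in degree 0 leaves no fixed points.              *)
Lemma rank2_not_acyclic (a0 : A) : a0 != 0 -> p.-group [set: A] ->
  tate0 A E -> ~ tateN1 A E.
Proof.
move=> nza pA T0 Tm.
have aug_p a : a \in aug A E -> a *+ p = 0.
  pose F := zmod_morphism (fun b c : A => mulrnDl p b c).
  suffices /subsetP sK : aug A E \subset 'ker F by move/sK; rewrite !inE => /eqP.
  apply: aug_sub => e b Ee; rewrite !inE /=; apply/eqP/(gsum0 e).
  by rewrite [LHS]gsum_gdiff rank2_expg // /gdiff gact1 subrr.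
have Nx1 (b : A) : gsum x p b *+ p = 0 -> gsum x p b = 0.
  move=> Nbp; apply: (gsum0 x b).2; apply/aug_p/Tm.
  by rewrite nrm_rank2; apply: (gsum0 y _).2.
have Nxk k (b : A) : gsum x p b *+ p ^ k = 0 -> gsum x p b = 0.
  elim: k b => [|k IHk] b //; rewrite expnSr mulrnA.
  by rewrite -(raddfMn (gsum x p)) => /Nx1; rewrite /= (raddfMn (gsum x p)) => /IHk.
have pE : p.-group E by rewrite /pgroup card_rank2 pnatM pnat_id.
have [k Ak0] := pgroup_zmodP _ p_pr pA.
have [b /T0[c ->]] := fixg_neq0 p_pr pA pE nza.
by rewrite nrm_rank2 (Nxk k c) ?Ak0 // (raddf0 (gsum y p)) eqxx.
Qed.

End RankTwo.

Section CenterModuleNorm.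

Variables (gT : finGroupType) (G N : {group gT}).
Hypothesis nsNG : (N <| G)%g.

Lemma expg_center_gsum (g : gT) (u : center_module G N) n : g \in G ->
  ((fmval u * g) ^+ n =
    fmval (gsum (subg (G / N) (coset N g)) n u : center_zmod N) * g ^+ n)%g.
Proof.
move=> Gg; have Ng := subsetP (normal_norm nsNG) g Gg.
elim: n => [|n IHn]; first by rewrite /gsum big_ord0 !expg0 mulg1.
rewrite expgSr IHn [in RHS]/gsum big_ord_recr fmvalA /=.
have -> : (subg (G / N) (coset N g) ^+ n = subg (G / N) (coset N (g ^+ n)))%g.
  by rewrite [coset N (g ^+ n)%g]morphX // [RHS]morphX ?mem_quotient.
rewrite center_actE ?groupX // expgSr -/(gsum _ _ _) !mulgA.
by rewrite mulgKV.
Qed.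

Lemma semi_abelian_gsum p (q : subg_of (G / N)) (u : center_module G N) :
  semi_abelian p G -> gsum q p u = 0 <-> u *+ p = 0.
Proof.
move=> saG.
have [g Ng Gg qE] := morphimP (valP q).
have -> : q = subg (G / N) (coset N g).
  by apply: val_inj; rewrite /= subgK ?mem_quotient.
have Gu : fmval u \in G.
  apply: subsetP (fmodP u); exact: subset_trans (center_sub N) (normal_sub nsNG).
have := saG (fmval u * g)%g g (groupM Gu Gg) Gg 1%N isT.
rewrite expn1 mulgK expg_center_gsum // => saug.
have eq0 (v : center_zmod N) : v = 0 <-> (fmval v = 1)%g.
  by split=> [->|v1]; [| apply: fmod_inj].
split=> [/eq0 s1 | /eq0].
  by apply/eq0; rewrite fmvalZ; apply/saug; rewrite s1 mul1g.
rewrite fmvalZ => /saug s1; apply/eq0.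
by apply: (mulIg (g ^+ p)%g); rewrite s1 mul1g.
Qed.

End CenterModuleNorm.

Theorem theorem1p1 (p : nat) (gT : finGroupType) (G N : {group gT}) :
  prime p -> (p.-group G)%g -> semi_abelian p G ->
  (N <| G)%g -> (N :!=: 1)%g ->
  ~~ cyclic (G / N)%g -> ~ generalized_quaternion (G / N)%G ->
  forall n : int, (tate_cohomology (center_module G N) n :!=: 1)%g.
Proof.
move=> p_pr pG saG nsNG ntN ncQ nqQ n; apply/eqP=> Hn0.
have isoQ := isog_subg (G / N)%G.
have pQ : p.-group [set: subg_of (G / N)].
  by rewrite -(isog_pgroup p isoQ) quotient_pgroup.
have pN : p.-group N := pgroupS (normal_sub nsNG) pG.
have pA : p.-group [set: center_module G N].
  apply/(pgroup_zmodP _ p_pr).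
  have /p_natP[k oZ] : p.-nat #|'Z(N)%g| := pgroupS (center_sub N) pN.
  exists k => u; apply: fmod_inj.
  by rewrite fmvalZ -oZ; apply: expg_cardG (fmodP u).
have [u nzu] : exists u : center_module G N, u != 0.
  have /trivgPn[z Zz nz1] : ('Z(N) != 1)%g.
    by rewrite center_nil_eq1 ?(pgroup_nil pN).
  exists (fmod (center_abelian N) z); apply: contra nz1 => /eqP z0.
  by rewrite -(fmodK (center_abelian N) Zz) [fmod _ _]z0.
have ncQ' : ~~ cyclic [set: subg_of (G / N)] by rewrite -(isog_cyclic isoQ).
have nqQ' : ~ generalized_quaternion [set: subg_of (G / N)]%G.
  by case=> m m_gt2 isoQm; apply: nqQ; exists m => //; apply: isog_trans isoQm.
have [x [y [_ _ ox oy [cxy nxy]]]] := exists_commuting_pair p_pr pQ ncQ' nqQ'.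
have T0 := tate0_of_tate_cohomology p_pr pQ pA Hn0.
pose E := (<[x]> <*> <[y]>)%G; have pE : p.-group E := pgroupS (subsetT _) pQ.
have T0E := tate0_sub p_pr pA pQ (subsetT E) T0.
apply: (rank2_not_acyclic p_pr ox oy cxy nxy _ nzu pA T0E).
  by move=> q a; apply: semi_abelian_gsum.
exact: (tate0_N1 p_pr pA pE).
Qed.
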